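(* Let $R$ be a Noetherian integral domain of Krull dimension one which contains a field of characteristic zero. Then each prime ideal of the polynomial ring $R[X]$ is a set theoretic complete intersection if and only if $R$ is a Dedekind domain with torsion ideal class group.
   Context: All rings are commutative with identity; $R[X]$ denotes the polynomial ring in one variable over $R$. An ideal $I$ of a ring $A$ is a set theoretic complete intersection if there exist $n$ elements $a_1, \ldots, a_n$ in $A$ such that $\mathrm{rad}(I) = \mathrm{rad}(a_1, \ldots, a_n)$, where $n$ is the height of $I$ and $\mathrm{rad}$ denotes the radical of an ideal. *)

(* Defs.v *)
From HB Require Import structures.
From mathcomp Require Import all_boot all_order all_algebra.
From mathcomp Require Import generic_quotient ring_quotient fraction.
From mathcomp Require Import boolp classical_sets.

Set Implicit Arguments.
Unset Strict Implicit.
Unset Printing Implicit Defensive.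

Import GRing.Theory.
Local Open Scope ring_scope.
Local Open Scope classical_set_scope.
Local Open Scope quotient_scope.

Local Notation tofrac := (@FracField.tofrac _).
Local Notation "x %:F" := (tofrac x).

Section Ideals.
Variable A : comNzRingType.
Implicit Types (I P M : set A).

Definition is_ideal I :=
  [/\ I 0, forall x y, I x -> I y -> I (x + y) & forall a x, I x -> I (a * x)].

(* The library's ideals are proper and are boolean predicates; [mem P] is the
   (classically decided) boolean membership in [P]. *)
Definition is_prime P := idealr_closed (mem P) /\ prime_idealr_closed (mem P).

Lemma is_primeP P :
  is_prime P <->
  [/\ is_ideal P, ~ P 1 & forall u v, P (u * v) -> P u \/ P v].
Proof.
split=> [[[P0 P1 PD] PM]|[[P0 PD PM] P1 Pp]].
- have P0' : P 0 by exact: set_mem.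
  split; [split=> // [x y Px Py|a x Px] | by move/mem_set; apply/negP|].
  + by apply/set_mem; rewrite -[x]mul1r; apply: PD; apply: mem_set.
  + by apply/set_mem; rewrite -[a * x]addr0; apply: PD; apply: mem_set.
  + move=> u v /mem_set /PM /orP[] /set_mem ?; [by left|by right].
- split; first split.
  + exact: mem_set.
  + by apply/negP => /set_mem.
  + move=> a x y /set_mem Px /set_mem Py; apply: mem_set.
    by apply: PD => //; apply: PM.
  + by move=> u v /set_mem /Pp[] /mem_set ?; apply/orP; [left|right].
Qed.

Definition is_maximal M :=
  [/\ is_ideal M, ~ M 1 &
      forall J, is_ideal J -> M `<=` J -> ~ J 1 -> J = M].

Definition ideal_gen n (a : 'I_n -> A) : set A :=
  [set x | exists c : 'I_n -> A, x = \sum_i c i * a i].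

Definition rad I : set A := [set x | exists n : nat, I (x ^+ n)].

Definition noetherian :=
  forall I, is_ideal I -> exists n (a : 'I_n -> A), I = ideal_gen a.

(* Only the values of [c] at 0, ..., n matter. *)
Definition prime_chain n (c : nat -> set A) :=
  (forall i, (i <= n)%N -> is_prime (c i)) /\
  (forall i, (i < n)%N -> c i `<` c i.+1).

(* Dimension and heights are relations with a natural number: an infinite
   dimension or height is not related to any [n]. *)
Definition krull_dim n :=
  (exists c, prime_chain n c) /\ (forall m c, prime_chain m c -> (m <= n)%N).

Definition prime_height P n :=
  (exists2 c, prime_chain n c & c n = P) /\
  (forall m c, prime_chain m c -> c m = P -> (m <= n)%N).

(* The least height of a prime containing [I]; a prime of infinite height does
   not bound [n], and the unit ideal has no height. *)
Definition height I n :=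
  (exists P, [/\ is_prime P, I `<=` P & prime_height P n]) /\
  (forall P m, is_prime P -> I `<=` P -> prime_height P m -> (n <= m)%N).

Definition set_theoretic_complete_intersection I :=
  exists n, height I n /\ exists a : 'I_n -> A, rad I = rad (ideal_gen a).

End Ideals.

(* A ring morphism out of a field is injective. *)
Definition contains_field_char0 (A : comNzRingType) :=
  exists k : fieldType, [pchar k] =i pred0 /\ inhabited {rmorphism k -> A}.

Definition integrally_closed (R : idomainType) :=
  forall z : {fraction R}, integralOver (@FracField.tofrac R) z -> exists x, z = x%:F.

(* A field is Dedekind with this convention. *)
Definition dedekind (R : idomainType) :=
  [/\ noetherian R, integrally_closed R &
      forall P : set R, is_prime P -> P <> [set 0] -> is_maximal P].

Section ClassGroup.
Variable R : idomainType.
Local Notation K := {fraction R}.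
Implicit Types (I J L : set K).

Definition fractional_ideal I :=
  [/\ I 0, forall x y, I x -> I y -> I (x + y),
      forall (r : R) x, I x -> I (r%:F * x) &
      exists2 d : R, d != 0 & forall x, I x -> exists r : R, d%:F * x = r%:F].

(* The image of [R] in its fraction field, the unit for the product. *)
Definition fr1 : set K := range (@FracField.tofrac R).

Definition frmul I J : set K :=
  [set z | exists2 s : seq (K * K),
     (forall p, p \in s -> I p.1 /\ J p.2) & z = \sum_(p <- s) p.1 * p.2].

Definition frscale (x : K) I : set K := [set x * z | z in I].

Lemma frmul_mem I J a b : I a -> J b -> frmul I J (a * b).
Proof.
move=> Ia Jb; exists [:: (a, b)]; last by rewrite big_seq1.
by move=> p; rewrite inE => /eqP ->.
Qed.

Lemma frmul_sub I J L :
    L 0 -> (forall x y, L x -> L y -> L (x + y)) ->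
    (forall a b, I a -> J b -> L (a * b)) ->
  frmul I J `<=` L.
Proof.
move=> L0 LD LM _ [s sIJ ->]; rewrite big_seq.
by elim/big_ind: _ => // p /sIJ[Ip Jp]; apply: LM.
Qed.

Lemma frmul0 I J : frmul I J 0.
Proof. by exists [::]; rewrite ?big_nil. Qed.

Lemma frmulD I J x y : frmul I J x -> frmul I J y -> frmul I J (x + y).
Proof.
move=> [s sIJ ->] [t tIJ ->]; exists (s ++ t); last by rewrite big_cat.
by move=> p; rewrite mem_cat => /orP[/sIJ|/tIJ].
Qed.

Lemma frmulC I J : frmul I J = frmul J I.
Proof.
apply/seteqP; split; apply: frmul_sub; try exact: frmul0; try exact: frmulD.
  by move=> a b Ia Jb; rewrite mulrC; apply: frmul_mem.
by move=> a b Ia Jb; rewrite mulrC; apply: frmul_mem.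
Qed.

Lemma frmulA I J L : frmul I (frmul J L) = frmul (frmul I J) L.
Proof.
have sub X Y Z : frmul X (frmul Y Z) `<=` frmul (frmul X Y) Z.
  apply: frmul_sub; [exact: frmul0|exact: frmulD|move=> a b Xa].
  suff: frmul Y Z `<=` [set b | frmul (frmul X Y) Z (a * b)] by apply.
  apply: frmul_sub => /= [|x y|c d Yc Zd].
  - by rewrite mulr0; apply: frmul0.
  - by rewrite mulrDr; apply: frmulD.
  - by rewrite mulrA; do 2?apply: frmul_mem.
apply/seteqP; split; first exact: sub.
rewrite (frmulC (frmul I J)) (frmulC I J) (frmulC I (frmul J L)) (frmulC J L).
exact: sub.
Qed.

Lemma fractional_ideal1 : fractional_ideal fr1.
Proof.
split.
- by exists 0 => //; rewrite rmorph0.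
- by move=> _ _ [x _ <-] [y _ <-]; exists (x + y) => //; rewrite rmorphD.
- by move=> r _ [x _ <-]; exists (r * x) => //; rewrite rmorphM.
- exists 1; first exact: oner_neq0.
  by move=> _ [x _ <-]; exists x; rewrite rmorph1 mul1r.
Qed.

Lemma frmul1 I : fractional_ideal I -> frmul fr1 I = I.
Proof.
move=> [I0 ID IM _]; apply/seteqP; split.
  by apply: frmul_sub => // _ b [r _ <-]; apply: IM.
move=> x Ix; rewrite -[x]mul1r; apply: frmul_mem => //.
by exists 1 => //; rewrite rmorph1.
Qed.

Lemma fractional_idealM I J :
  fractional_ideal I -> fractional_ideal J -> fractional_ideal (frmul I J).
Proof.
move=> [I0 ID IM [d d0 dI]] [J0 JD JM [e e0 eJ]]; split.
- exact: frmul0.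
- exact: frmulD.
- move=> r x IJx; suff: frmul I J `<=` [set x | frmul I J (r%:F * x)] by apply.
  apply: frmul_sub => /= [|y z|a b Ia Jb].
  + by rewrite mulr0; apply: frmul0.
  + by rewrite mulrDr; apply: frmulD.
  + by rewrite mulrA; apply: frmul_mem => //; apply: IM.
- exists (d * e); first by rewrite mulf_neq0.
  apply: frmul_sub => /= [|y z [r yr] [s zs]|a b /dI[r ar] /eJ[s bs]].
  + by exists 0; rewrite mulr0 rmorph0.
  + by exists (r + s); rewrite mulrDr yr zs rmorphD.
  + by exists (r * s); rewrite !rmorphM mulrACA ar bs.
Qed.

Definition invertible I :=
  fractional_ideal I /\ exists2 J, fractional_ideal J & frmul J I = fr1.

Lemma invertible1 : invertible fr1.
Proof.
split; first exact: fractional_ideal1.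
by exists fr1; [exact: fractional_ideal1|rewrite frmul1//; exact: fractional_ideal1].
Qed.

Lemma invertibleM I J : invertible I -> invertible J -> invertible (frmul I J).
Proof.
move=> [fI [I' fI' II]] [fJ [J' fJ' JJ]]; split; first exact: fractional_idealM.
exists (frmul J' I'); first exact: fractional_idealM.
by rewrite -frmulA [frmul I' _]frmulA II frmul1.
Qed.

Record invertible_ideal := InvertibleIdeal {
  invertible_set :> set K;
  invertible_setP : invertible invertible_set }.

Lemma invertible_ideal_inj (I J : invertible_ideal) :
  I = J :> set K -> I = J.
Proof.
by case: I J => [I iI] [J iJ] /= IJ; subst J; congr InvertibleIdeal.
Qed.

HB.instance Definition _ := gen_eqMixin invertible_ideal.
HB.instance Definition _ := gen_choiceMixin invertible_ideal.

Definition inv1 := InvertibleIdeal invertible1.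
Definition invM (I J : invertible_ideal) :=
  InvertibleIdeal (invertibleM (invertible_setP I) (invertible_setP J)).

Lemma invV_ex (I : invertible_ideal) :
  exists J : invertible_ideal, frmul J I = fr1.
Proof.
case: (invertible_setP I) => fI [J fJ JI].
have iJ : invertible J by split=> //; exists I => //; rewrite frmulC.
by exists (InvertibleIdeal iJ).
Qed.
Definition invV (I : invertible_ideal) := projT1 (cid (invV_ex I)).

(* Equality modulo the nonzero principal fractional ideals. *)
Definition same_class (I J : invertible_ideal) :=
  `[< exists2 x : K, x != 0 & I = frscale x J :> set K >].

Lemma frscale_mul x y I J :
  frmul (frscale x I) (frscale y J) = frscale (x * y) (frmul I J).
Proof.
apply/seteqP; split.
  apply: frmul_sub.
  - by exists 0; rewrite ?mulr0//; apply: frmul0.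
  - move=> _ _ [a Ia <-] [b Ib <-]; exists (a + b); rewrite ?mulrDr//.
    exact: frmulD.
  - move=> _ _ [a Ia <-] [b Jb <-]; exists (a * b); last by rewrite mulrACA.
    exact: frmul_mem.
move=> _ [z IJz <-].
suff: frmul I J `<=` [set z | frmul (frscale x I) (frscale y J) (x * y * z)].
  by apply.
apply: frmul_sub => /= [|a b|a b Ia Jb].
- by rewrite mulr0; apply: frmul0.
- by rewrite mulrDr; apply: frmulD.
- by rewrite mulrACA; apply: frmul_mem; [exists a|exists b].
Qed.

Lemma frscaleM x y I : frscale x (frscale y I) = frscale (x * y) I.
Proof.
apply/seteqP; split=> [_ [_ [z Iz <-] <-]|_ [z Iz <-]].
  by exists z => //; rewrite mulrA.
by exists (y * z); [exists z|rewrite mulrA].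
Qed.

Lemma frscale1 I : frscale 1 I = I.
Proof.
apply/seteqP; split=> [_ [z Iz <-]|z Iz]; first by rewrite mul1r.
by exists z => //; rewrite mul1r.
Qed.

Lemma same_class_refl : reflexive same_class.
Proof. by move=> I; apply/asboolP; exists 1; rewrite ?oner_neq0 ?frscale1. Qed.

Lemma same_class_sym : symmetric same_class.
Proof.
have sub (I J : invertible_ideal) : same_class I J -> same_class J I.
  move=> /asboolP[x x0 IJ]; apply/asboolP; exists x^-1; first by rewrite invr_neq0.
  by rewrite IJ frscaleM mulVf// frscale1.
by move=> I J; apply/idP/idP; apply: sub.
Qed.

Lemma same_class_trans : transitive same_class.
Proof.
move=> J I L /asboolP[x x0 IJ] /asboolP[y y0 JL]; apply/asboolP.
by exists (x * y); rewrite ?mulf_neq0// IJ JL frscaleM.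
Qed.

Canonical same_class_equiv :=
  EquivRel same_class same_class_refl same_class_sym same_class_trans.

Definition class_group := {eq_quot same_class}.
HB.instance Definition _ : EqQuotient _ same_class class_group :=
  EqQuotient.on class_group.
HB.instance Definition _ := Choice.on class_group.

Definition ideal_class (I : invertible_ideal) : class_group := \pi_class_group I.

Lemma ideal_classP (I J : invertible_ideal) :
  ideal_class I = ideal_class J <-> same_class I J.
Proof. by split=> [/eqP|H]; [|apply/eqP]; rewrite /ideal_class piE. Qed.

Definition cl1 : class_group := ideal_class inv1.
Definition clM (a b : class_group) : class_group :=
  ideal_class (invM (repr a) (repr b)).
Definition clV (a : class_group) : class_group := ideal_class (invV (repr a)).

Lemma ideal_class_repr a : ideal_class (repr a) = a.
Proof. exact: reprK. Qed.

Lemma clME (I J : invertible_ideal) : clM (ideal_class I) (ideal_class J) = ideal_class (invM I J).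
Proof.
apply/ideal_classP.
have /ideal_classP/asboolP[x x0 xI] := ideal_class_repr (ideal_class I).
have /ideal_classP/asboolP[y y0 yJ] := ideal_class_repr (ideal_class J).
apply/asboolP; exists (x * y); first by rewrite mulf_neq0.
by rewrite /= xI yJ frscale_mul.
Qed.

Lemma clMA : associative clM.
Proof.
move=> a b c; rewrite -[a]ideal_class_repr -[b]ideal_class_repr.
rewrite -[c]ideal_class_repr !clME; congr ideal_class.
by apply: invertible_ideal_inj; apply: frmulA.
Qed.

Lemma clMC : commutative clM.
Proof.
move=> a b; congr ideal_class.
by apply: invertible_ideal_inj; apply: frmulC.
Qed.

Lemma cl1M : left_id cl1 clM.
Proof.
move=> a; rewrite -[a]ideal_class_repr clME; congr ideal_class.
by apply: invertible_ideal_inj; apply: frmul1; case: (invertible_setP (repr a)).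
Qed.

Lemma clM1 : right_id cl1 clM.
Proof. by move=> a; rewrite clMC cl1M. Qed.

Lemma clVM : left_inverse cl1 clV clM.
Proof.
move=> a; rewrite -{2}[a]ideal_class_repr clME; congr ideal_class.
by apply: invertible_ideal_inj; rewrite /= /invV; case: cid.
Qed.

Lemma clMV : right_inverse cl1 clV clM.
Proof. by move=> a; rewrite clMC clVM. Qed.

HB.instance Definition _ :=
  isGroup.Build class_group clMA cl1M clM1 clVM clMV.

Lemma ideal_classX (I : invertible_ideal) n :
  (ideal_class I ^+ n)%g = ideal_class (iter n (invM I) inv1).
Proof.
elim: n => [|n IHn]; first exact: expg0.
by rewrite expgS IHn; exact: clME.
Qed.

End ClassGroup.

Definition torsion (G : groupType) :=
  forall g : G, exists2 n, (0 < n)%N & (g ^+ n = 1)%g.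

Lemma torsion_class_groupP (R : idomainType) :
  torsion (class_group R) <->
  (forall I : set {fraction R}, invertible I ->
    exists2 n, (0 < n)%N &
      exists2 x, x != 0 & iter n (frmul I) (@fr1 R) = frscale x (@fr1 R)).
Proof.
have iterE (I : invertible_ideal R) n :
    iter n (invM I) (inv1 R) = iter n (frmul I) (@fr1 R) :> set _.
  by elim: n => //= n ->.
split=> H.
  move=> I iI; have [n n0] := H (ideal_class (InvertibleIdeal iI)).
  rewrite ideal_classX => /ideal_classP/asboolP[x x0 E].
  by exists n => //; exists x => //; rewrite -[LHS](iterE (InvertibleIdeal iI)).
move=> g; rewrite -[g]ideal_class_repr.
have [n n0 [x x0 E]] := H _ (invertible_setP (repr g)).
exists n => //; rewrite ideal_classX; apply/ideal_classP/asboolP.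
by exists x => //; rewrite iterE.
Qed.

(* Main.v *)
Require Import Defs.
From mathcomp Require Import all_boot all_algebra.
From mathcomp Require Import classical_sets.
From mathcomp Require Import generic_quotient fraction boolp ring.

(** Why the theorem holds. Write K for the fraction field of R.

    Necessity. Let z in K be integral over R and let P be the kernel of
    R[X] -> K, X |-> z, a prime of height one. If P is the radical of f, then f
    is a constant times a power of X - z over K, and its leading coefficient is a
    unit because f divides a power of a monic polynomial. So R contains the
    coefficients of (X - z)^j for some j > 0, in particular - j z, and j is
    invertible in R: thus z is in R ([stci_integrally_closed]). This is where
    characteristic zero enters. Dimension one then makes R a Dedekind domain.
    For a maximal ideal M, the extension M R[X] is a prime of height one; if it is
    the radical of f, then f divides a nonzero constant, so it is a constant a,
    and a R is a power of M since M is its radical ([polyI_stci_power]). As every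
    nonzero ideal is a product of maximal ideals, the class group is torsion.

    Sufficiency. Over a Dedekind domain with torsion class group every nonzero
    ideal has a principal power ([torsion_generator]). Let P be a nonzero prime of
    R[X] and p its contraction to R.
    - If p = 0, then P K[X] is generated by some g in R[X]. With c(g) the content
      of g and c(g)^n = a R, the polynomial g^n / a has coefficients in R, and P is
      its radical by Gauss' lemma ([contraction0_stci]).
    - If P = p R[X] and p^n = a R, then P is the radical of a ([polyI_stci]).
    - Otherwise P has height two; it is generated by one polynomial g modulo
      p R[X], so that it is the radical of (g, a) ([height2_stci]).

    Two facts carry both directions. The height of
    the primes of R[X] rests on [incomparability]: of two distinct comparable
    primes with the same contraction p, the smaller is p R[X]. The arithmetic of
    Dedekind domains rests on [maximal_invertible]: nonzero maximal ideals are
    invertible. It yields the factorization of ideals, and the primitive multiples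
    ([primitive_multiple]) that give both Gauss' lemma and the height of p R[X]. *)

Set Implicit Arguments.
Unset Strict Implicit.
Unset Printing Implicit Defensive.

Import GRing.Theory.

(** * Ideals of commutative rings *)

Section Ideals.
Local Open Scope ring_scope.
Local Open Scope classical_set_scope.
Variable A : comNzRingType.
Implicit Types (I J P M Q : set A).

Lemma prime_ideal P : is_prime P -> is_ideal P.
Proof. by case/is_primeP. Qed.

Lemma prime1 P : is_prime P -> ~ P 1.
Proof. by case/is_primeP. Qed.

Lemma primeM P x y : is_prime P -> P (x * y) -> P x \/ P y.
Proof. by case/is_primeP=> _ _; apply. Qed.

Lemma primeX P x k : is_prime P -> P (x ^+ k) -> P x.
Proof.
move=> pP; elim: k => [/(prime1 pP)//|k IHk].
by rewrite exprS => /(primeM pP)[//|/IHk].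
Qed.

Lemma idealN I x : is_ideal I -> I x -> I (- x).
Proof. by case=> _ _ IM Ix; rewrite -mulN1r; apply: IM. Qed.

Lemma idealB I x y : is_ideal I -> I x -> I y -> I (x - y).
Proof. by move=> iI Ix /(idealN iI); case: iI => _ ID _; apply: ID. Qed.

Lemma idealMr I a x : is_ideal I -> I x -> I (x * a).
Proof. by case=> _ _ IM Ix; rewrite mulrC; apply: IM. Qed.

Lemma ideal_sum I (T : Type) (r : seq T) (P : pred T) (F : T -> A) :
  is_ideal I -> (forall i, P i -> I (F i)) -> I (\sum_(i <- r | P i) F i).
Proof. by case=> I0 ID _ IF; apply: big_ind. Qed.

Lemma idealX I x k : is_ideal I -> I x -> I (x ^+ k.+1).
Proof. by move=> iI Ix; rewrite exprS; apply: idealMr. Qed.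

Lemma ideal_unit I : is_ideal I -> I 1 -> I = setT.
Proof.
case=> _ _ IM I1; apply/seteqP; split=> // x _.
by rewrite -[x]mulr1; apply: IM.
Qed.

Lemma ideal_gen_sub n (a : 'I_n -> A) I :
  is_ideal I -> (forall i, I (a i)) -> ideal_gen a `<=` I.
Proof. by move=> iI Ia _ [c ->]; apply: ideal_sum => // i _; case: iI => _ _; apply. Qed.

Lemma ideal_gen_ideal n (a : 'I_n -> A) : is_ideal (ideal_gen a).
Proof.
split=> [|_ _ [c ->] [d ->]|b _ [c ->]].
- by exists (fun=> 0); rewrite big1// => i _; rewrite mul0r.
- exists (fun i => c i + d i); rewrite -big_split.
  by apply: eq_bigr => i _; rewrite mulrDl.
- by exists (fun i => b * c i); rewrite mulr_sumr; apply: eq_bigr => i _; rewrite mulrA.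
Qed.

Lemma ideal_gen_mem n (a : 'I_n -> A) i : ideal_gen a (a i).
Proof.
exists (fun j => (j == i)%:R); rewrite (bigD1 i)//= eqxx mul1r.
by rewrite big1 ?addr0// => j /negPf ->; rewrite mul0r.
Qed.

Lemma ideal_gen1P (a : 'I_1 -> A) x :
  ideal_gen a x <-> exists c, x = c * a ord0.
Proof.
split=> [[c ->]|[c ->]]; first by exists (c ord0); rewrite big_ord1.
by exists (fun=> c); rewrite big_ord1.
Qed.

Lemma ideal_zero : is_ideal [set (0 : A)].
Proof.
split=> //= [x y -> ->|a x ->]; first by rewrite addr0.
by rewrite mulr0.
Qed.

(** Otherwise dependent choice would give a strictly increasing sequence of
    ideals, and the finitely many generators of its union all occur in one
    term of the sequence. *)
Lemma noetherian_max (F : set (set A)) I0 :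
    noetherian A -> (forall I, F I -> is_ideal I) -> F I0 ->
  exists2 I, F I & forall J, F J -> I `<=` J -> J = I.
Proof.
move=> noethA Fid FI0; apply: contrapT => noMax.
have /choice[f fP] : forall I : {I | F I}, exists J : {J | F J}, sval I `<` sval J.
  move=> [I FI] /=; apply: contrapT => noJ; apply: noMax; exists I => // J FJ IJ.
  apply: contrapT => JI; apply: noJ; exists (exist _ J FJ) => /=.
  by split=> // JI'; apply: JI; apply/seteqP; split.
pose c k := iter k f (exist _ I0 FI0).
have cS k : sval (c k) `<` sval (c k.+1) by apply: fP.
have cle j k : (j <= k)%N -> sval (c j) `<=` sval (c k).
  move=> /subnK <-; elim: (k - j)%N => // m IHm; apply: subset_trans IHm _.
  by rewrite addSn; case: (cS (m + j)%N).
have ci k : is_ideal (sval (c k)) by apply: Fid; apply: svalP.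
pose U := [set x | exists k, sval (c k) x].
have iU : is_ideal U.
  split=> [|x y [j cx] [k cy]|a x [k cx]].
  - by exists 0%N; case: (ci 0%N).
  - exists (maxn j k); case: (ci (maxn j k)) => _ cD _.
    by apply: cD; [apply: (cle j); rewrite ?leq_maxl|apply: (cle k); rewrite ?leq_maxr].
  - by exists k; case: (ci k) => _ _; apply.
have [n [a Ua]] := noethA _ iU.
have /choice[k kP] : forall i, exists k, sval (c k) (a i).
  by move=> i; have : U (a i) by rewrite Ua; apply: ideal_gen_mem.
have [_] := cS (\max_i k i)%N; apply => x cx.
suff : ideal_gen a `<=` sval (c (\max_i k i)%N).
  by apply; rewrite -Ua; exists (\max_i k i).+1.
apply: ideal_gen_sub => // i; apply: (cle (k i)) (kP i).
exact: leq_bigmax.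
Qed.

Lemma maximal_exists I :
  noetherian A -> is_ideal I -> ~ I 1 -> exists2 M, is_maximal M & I `<=` M.
Proof.
move=> noethA iI I1.
pose F := [set J | [/\ is_ideal J, I `<=` J & ~ J 1]].
have [||M [iM IM M1] maxM] := @noetherian_max F I noethA; last 1 first.
- exists M => //; split=> // J iJ MJ J1; apply: maxM => //; split=> //.
  exact: subset_trans MJ.
- by move=> J [].
- by split.
Qed.

Lemma maximal_inv_mod M x :
  is_maximal M -> ~ M x -> exists c, M (1 - c * x).
Proof.
move=> [iM M1 maxM] Mx; case: (iM) => M0 MD MM.
pose J := [set y | exists c, M (y - c * x)].
have MJ : M `<=` J by move=> y My; exists 0; rewrite mul0r subr0.
have iJ : is_ideal J.
  split=> [|y z [c yc] [d zd]|a y [c yc]]; first exact: MJ.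
    by exists (c + d); rewrite mulrDl opprD addrACA; apply: MD.
  by exists (a * c); rewrite -mulrA -mulrBr; apply: MM.
suff : J 1 by [].
apply: contrapT => J1; apply: Mx; rewrite -(maxM J)//.
by exists 1; rewrite mul1r subrr.
Qed.

Lemma maximal_prime M : is_maximal M -> is_prime M.
Proof.
move=> mM; case: (mM) => iM M1 _; apply/is_primeP; split=> // x y Mxy.
have [Mx|Mx] := pselect (M x); [by left|right].
have [c Mc] := maximal_inv_mod mM Mx.
rewrite -[y](subrK (c * x * y)) -{1}[y]mul1r -mulrBl.
by case: (iM) => _ MD MM; apply: MD; [apply: idealMr|rewrite -mulrA; apply: MM].
Qed.

Lemma maximal_sub M P : is_maximal M -> is_prime P -> M `<=` P -> P = M.
Proof.
by move=> [_ _ maxM] pP MP; apply: maxM => //; [apply: prime_ideal|apply: prime1].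
Qed.

(** * Heights *)

Definition height_le P n := forall m c, prime_chain m c -> c m = P -> (m <= n)%N.

Lemma prime_chain_pred m (c : nat -> set A) : prime_chain m.+1 c -> prime_chain m c.
Proof.
by move=> [cp cS]; split=> i ?; [apply: cp; apply: ltnW|apply: cS; apply: ltnW].
Qed.

Lemma prime_chain_rcons m (c : nat -> set A) P :
    prime_chain m c -> is_prime P -> c m `<` P ->
  exists2 c', prime_chain m.+1 c' & c' m.+1 = P.
Proof.
move=> [cp cS] pP cP; exists (fun i => if (i <= m)%N then c i else P).
  split=> i; first by case: ifP => [/cp|].
  rewrite ltnS => im; rewrite im; move: im; rewrite leq_eqVlt.
  by case/predU1P=> [->|im]; [rewrite ltnn|rewrite im; apply: cS].
by rewrite ltnn.
Qed.

Lemma prime_height0 : is_prime [set (0 : A)] -> prime_height [set (0 : A)] 0.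
Proof.
move=> p0; split; first by exists (fun=> [set 0]).
move=> [//|m] c [cp cS] c0; have [_ []] := cS m (leqnn _).
rewrite c0 => _ ->; have [] // : is_ideal (c m).
by apply: prime_ideal; apply: cp.
Qed.

Lemma prime_heightS P Q n :
    is_prime P -> prime_height Q n -> Q `<` P ->
    (forall Q', is_prime Q' -> Q' `<` P -> height_le Q' n) ->
  prime_height P n.+1.
Proof.
move=> pP [[c cc cQ] _] QP Pn; split.
  by apply: (prime_chain_rcons cc); rewrite ?cQ.
move=> [//|m] d cd dP; apply: (Pn (d m)) (prime_chain_pred cd) erefl.
  by case: cd => dp _; apply: dp.
by rewrite -dP; case: cd => _; apply.
Qed.

Lemma prime_height1 P :
    is_prime [set (0 : A)] -> is_prime P -> P <> [set 0] ->
    (forall Q, is_prime Q -> Q `<` P -> Q = [set 0]) ->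
  prime_height P 1.
Proof.
move=> p0 pP Pn0 Pmin; apply: (prime_heightS pP (prime_height0 p0)).
  split; first by move=> _ ->; have [] := prime_ideal pP.
  by move=> P0; apply: Pn0; apply/seteqP; split=> // _ ->; have [] := prime_ideal pP.
by move=> Q pQ /Pmin -> //; have [] := prime_height0 p0.
Qed.

(** A longest chain of primes ending at [P] extends to any larger prime. *)
Lemma height_prime P n : prime_height P n -> height P n.
Proof.
move=> hP; have [[c cc cP] _] := hP.
have pP : is_prime P by rewrite -cP; case: cc => cp _; apply: cp.
split; first by exists P; split.
move=> Q m pQ PQ [_ Qm]; have [QP|QP] := pselect (Q `<=` P).
  by apply: Qm cc _; rewrite cP; apply/seteqP; split.
have [|d cd dQ] := prime_chain_rcons cc pQ; first by rewrite cP.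
by apply: ltnW; apply: Qm cd dQ.
Qed.

Lemma height_uniq I m n : height I m -> height I n -> m = n.
Proof.
move=> [[P [pP IP hP]] mI] [[Q [pQ IQ hQ]] nI]; apply/eqP; rewrite eqn_leq.
by rewrite (mI Q)// (nI P).
Qed.

(** * Set theoretic complete intersections *)

Lemma stci_intro P n (a : 'I_n -> A) :
    prime_height P n -> (forall i, P (a i)) ->
    (forall x, P x -> exists k, ideal_gen a (x ^+ k)) ->
  set_theoretic_complete_intersection P.
Proof.
move=> hP Pa Pk; exists n; split; [exact: height_prime|exists a].
have pP : is_prime P by case: hP => -[c [cp _] <-] _; apply: cp.
apply/seteqP; split=> x [k]; first by move=> /(primeX pP)/Pk.
by move=> /(ideal_gen_sub (prime_ideal pP) Pa) Pxk; exists k.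
Qed.

Lemma stci_height1 P :
    prime_height P 1 -> set_theoretic_complete_intersection P ->
  exists2 a, P a & forall x, P x -> exists k c, x ^+ k = c * a.
Proof.
move=> hP [n [hn [a]]]; have n1 := height_uniq hn (height_prime hP); subst n.
have pP : is_prime P by case: hP => -[c [cp _] <-] _; apply: cp.
move=> radP; exists (a ord0).
  have : Defs.rad (ideal_gen a) (a ord0).
    by exists 1%N; rewrite expr1; apply: ideal_gen_mem.
  by rewrite -radP => -[k /(primeX pP)].
move=> x Px; have : Defs.rad P x by exists 1%N; rewrite expr1.
by rewrite radP => -[k /ideal_gen1P]; exists k.
Qed.

End Ideals.

(** * Ideals in the fraction field *)

Section FractionalIdeals.
Local Open Scope ring_scope.
Local Open Scope classical_set_scope.
Local Open Scope quotient_scope.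
Variable R : idomainType.
Local Notation K := {fraction R}.
Local Notation tofrac := (@FracField.tofrac R).
Local Notation "x %:F" := (tofrac x).
Implicit Types (I M : set R) (X Y Z : set K).

Lemma tofrac_inj : injective tofrac.
Proof. by move=> x y /eqP; rewrite tofrac_eq => /eqP. Qed.

Lemma fracP (z : K) : exists2 b : R, b != 0 & exists a : R, b%:F * z = a%:F.
Proof.
elim/quotW: z => x; exists \d_x; rewrite ?denom_ratioP//; exists \n_x.
unlock FracField.tofrac; rewrite -[LHS]FracField.pi_mul; apply/eqmodP.
rewrite /= FracField.equivfE /FracField.mulf.
by rewrite !numden_Ratio ?oner_eq0 ?mul1r ?mulr1 ?denom_ratioP// mulrC.
Qed.

Definition inK I : set K := [set x%:F | x in I].

Lemma inKE I x : inK I x%:F <-> I x.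
Proof. by split=> [[y Iy /tofrac_inj <-]|Ix] //; exists x. Qed.

Lemma fr1_tofrac x : @fr1 R x%:F.
Proof. by exists x. Qed.

Lemma inK_fr1 I : inK I `<=` @fr1 R.
Proof. by move=> _ [x _ <-]; exists x. Qed.

Lemma fractional_inK I : is_ideal I -> fractional_ideal (inK I).
Proof.
case=> I0 ID IM; split.
- by exists 0; rewrite ?rmorph0.
- by move=> _ _ [x Ix <-] [y Iy <-]; exists (x + y); rewrite ?rmorphD//; apply: ID.
- by move=> r _ [x Ix <-]; exists (r * x); rewrite ?rmorphM//; apply: IM.
- by exists 1; rewrite ?oner_neq0// => _ [x _ <-]; exists x; rewrite rmorph1 mul1r.
Qed.

Lemma fractional_sub1 X :
  fractional_ideal X -> X `<=` @fr1 R -> exists2 I, is_ideal I & X = inK I.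
Proof.
move=> [X0 XD XM _] X1; exists (tofrac @^-1` X); first split=> /=.
- by rewrite rmorph0.
- by move=> x y ? ?; rewrite rmorphD; apply: XD.
- by move=> a x ?; rewrite rmorphM; apply: XM.
apply/seteqP; split=> [z Xz|_ [x Xx <-]//].
by have [x _ xz] := X1 _ Xz; exists x => //=; rewrite xz.
Qed.

Lemma frmulS X X' Y Y' : X `<=` X' -> Y `<=` Y' -> frmul X Y `<=` frmul X' Y'.
Proof.
move=> XX YY; apply: frmul_sub => [||a b /XX Xa /YY Yb].
- exact: frmul0.
- exact: frmulD.
- exact: frmul_mem.
Qed.

Lemma frmulr1 X : fractional_ideal X -> frmul X (@fr1 R) = X.
Proof. by rewrite frmulC; apply: frmul1. Qed.

Definition frpow X n := iter n (frmul X) (@fr1 R).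

Lemma frpowS X n : frpow X n.+1 = frmul X (frpow X n).
Proof. by []. Qed.

Lemma frpow1 n : frpow (@fr1 R) n = @fr1 R.
Proof. by elim: n => //= n ->; apply/frmul1/fractional_ideal1. Qed.

Lemma frpow_mul X Y n : frpow (frmul X Y) n = frmul (frpow X n) (frpow Y n).
Proof.
elim: n => [|n IHn]; first by rewrite frmul1//; apply: fractional_ideal1.
by rewrite !frpowS IHn -!frmulA (frmulA Y) (frmulC Y) -!frmulA.
Qed.

Lemma frpowD X m n : frpow X (m + n) = frmul (frpow X m) (frpow X n).
Proof.
elim: m => [|m IHm]; last by rewrite addSn !frpowS IHm frmulA.
elim: n => [|n IHn]; first by rewrite frmul1//; apply: fractional_ideal1.
by rewrite add0n in IHn *; rewrite frpowS frmulA (frmulC _ X) -frmulA -IHn.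
Qed.

Lemma frpow_exp X m n : frpow X (m * n) = frpow (frpow X m) n.
Proof. by elim: n => [|n IHn]; rewrite ?muln0// mulnS frpowD IHn. Qed.

Lemma frpow_scale x X n : frpow (frscale x X) n = frscale (x ^+ n) (frpow X n).
Proof.
elim: n => [|n IHn]; first by rewrite expr0 frscale1.
by rewrite !frpowS IHn frscale_mul exprS.
Qed.

Lemma frpowS_sub X Y n : X `<=` Y -> frpow X n `<=` frpow Y n.
Proof. by move=> XY; elim: n => [|n IHn] //; apply: frmulS. Qed.

Lemma frpow_sub X n : fractional_ideal X -> X `<=` @fr1 R -> frpow X n.+1 `<=` X.
Proof.
move=> fX X1; rewrite -{2}[X]frmulr1//.
by apply: frmulS => //; rewrite -[X in _ `<=` X](frpow1 n); apply: frpowS_sub.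
Qed.

Lemma frscale1P x z : frscale x (@fr1 R) z <-> exists r, z = r%:F * x.
Proof.
split=> [[_ [r _ <-] <-]|[r ->]]; first by exists r; rewrite mulrC.
by exists r%:F; [exact: fr1_tofrac|rewrite mulrC].
Qed.

(** * Dedekind domains *)

(** With generators of [I], multiplication by [y] is given by a matrix over
    [R], and [y] is an eigenvalue of that matrix. *)
Lemma integral_stable I y :
    noetherian R -> is_ideal I -> I <> [set 0] ->
    (forall x, I x -> inK I (y * x%:F)) ->
  integralOver tofrac y.
Proof.
move=> noethR iI In0 Iy; have [n [a Ia]] := noethR _ iI.
have /choice[C CP] : forall i, exists c : 'I_n -> R,
    y * (a i)%:F = \sum_j (c j)%:F * (a j)%:F.
  move=> i; have /Iy[x] : I (a i) by rewrite Ia; apply: ideal_gen_mem.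
  rewrite Ia => -[c ->] <-; exists c; rewrite rmorph_sum.
  by apply: eq_bigr => j _; rewrite rmorphM.
exists (char_poly (\matrix_(i, j) C j i)); first exact: char_poly_monic.
rewrite map_char_poly -eigenvalue_root_char; apply/eigenvalueP.
exists (\row_j (a j)%:F).
  apply/rowP => i; rewrite !mxE CP; apply: eq_bigr => j _.
  by rewrite !mxE mulrC.
apply: contra_notN In0 => /eqP a0; apply/seteqP; split=> [|_ ->]; last by case: iI.
rewrite Ia => _ [c ->] /=; apply: big1 => i _; suff -> : a i = 0 by rewrite mulr0.
by apply: tofrac_inj; have /rowP/(_ i) := a0; rewrite !mxE rmorph0.
Qed.

Lemma ideal_neq0_mem I : is_ideal I -> I <> [set 0] -> exists2 a, I a & a != 0.
Proof.
move=> [I0 _ _] In0; apply: contrapT => nI; apply: In0.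
apply/seteqP; split=> [x Ix|_ -> //]; apply: contrapT => x0.
by apply: nI; exists x => //; apply/eqP.
Qed.

(** A maximal ideal is the annihilator of [b] modulo some [a != 0], because a
    maximal one among the annihilators contained in [M] is prime. The fraction
    [b / a] is then what is sought. *)
Lemma maximal_colon M :
    noetherian R -> (forall P : set R, is_prime P -> P <> [set 0] -> is_maximal P) ->
    is_maximal M -> M <> [set 0] ->
  exists2 y, ~ @fr1 R y & forall x, M x -> @fr1 R (y * x%:F).
Proof.
move=> noethR dim1 mM Mn0; have pM := maximal_prime mM.
have iM := prime_ideal pM; have [a Ma a0] := ideal_neq0_mem iM Mn0.
(* the annihilator of [b] modulo [a] *)
pose colon b := [set r | exists c, r * b = c * a].
have icolon b : is_ideal (colon b).
  split=> [|x y [c xc] [d yd]|e x [c xc]].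
  - by exists 0; rewrite !mul0r.
  - by exists (c + d); rewrite !mulrDl xc yd.
  - by exists (e * c); rewrite -!mulrA xc.
pose F := [set q | (exists b, q = colon b) /\ q `<=` M].
have [||q [[b qb] qM] maxq] := @noetherian_max R F (colon 1) noethR.
- by move=> _ [[b ->] _].
- split; first by exists 1.
  by move=> x [c]; rewrite mulr1 => ->; case: iM => _ _; apply.
have maxc u : colon (b * u) `<=` M -> colon (b * u) = q.
  move=> cM; apply: maxq; first by split=> //; exists (b * u).
  by rewrite qb => x [c xc]; exists (c * u); rewrite mulrA xc mulrAC.
have pq : is_prime q.
  apply/is_primeP; split; [by rewrite qb|by move=> /qM/(prime1 pM)|move=> u v quv].
  have [qu|qu] := pselect (q u); [by left|right].
  have quv' : colon (b * u) v.
    by move: quv; rewrite qb => -[c uvc]; exists c; rewrite -uvc; ring.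
  (* Either [colon (b * u)] is [q] by maximality, or it has an element [t] outside
     [M]; then [colon (b * t)] is contained in [M], so it is [q] and contains [u]. *)
  have [/maxc <- //|/existsNP[t /not_implyP[[c tbu] Mt]]] := pselect (colon (b * u) `<=` M).
  exfalso; apply: qu; rewrite -(maxc t) => [|s [d sbt]].
    by exists c; rewrite -tbu; ring.
  have /qM/(primeM pM)[//|//] : q (s * t) by rewrite qb; exists d; rewrite -sbt; ring.
have qa : q a by rewrite qb; exists b; rewrite mulrC.
have Mq : M = q.
  apply: maximal_sub => //; apply: dim1 => // q0.
  by move: qa a0; rewrite q0 => ->; rewrite eqxx.
have aF : a%:F != 0 by rewrite tofrac_eq0.
exists (b%:F / a%:F) => [[c _ cE]|x].
  apply: (prime1 pq); rewrite qb; exists c; rewrite mul1r.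
  by apply: tofrac_inj; rewrite rmorphM /= cE divfK.
rewrite Mq qb => -[c xb]; exists c => //.
by apply: (mulIf aF); rewrite -rmorphM -xb rmorphM mulrAC divfK// mulrC.
Qed.

Section Dedekind.
Hypothesis dedR : dedekind R.

Let noethR : noetherian R. Proof. by case: dedR. Qed.
Let dim1 (P : set R) : is_prime P -> P <> [set 0] -> is_maximal P.
Proof. by case: dedR => _ _; apply. Qed.

Lemma stable_fr1 I y :
    is_ideal I -> I <> [set 0] -> (forall x, I x -> inK I (y * x%:F)) ->
  @fr1 R y.
Proof.
move=> iI In0 Iy; have [_ nR _] := dedR.
by have [x ->] := nR _ (integral_stable noethR iI In0 Iy); apply: fr1_tofrac.
Qed.

(** The fraction [y] of [maximal_colon] does not map [M] to itself, as it would
    be integral; so [M] and [y * M] generate the unit ideal. *)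
Lemma maximal_invertible M : is_maximal M -> M <> [set 0] -> invertible (inK M).
Proof.
move=> mM Mn0; have iM : is_ideal M by case: mM.
split; first exact: fractional_inK.
have [y yR yM] := maximal_colon noethR dim1 mM Mn0.
have [a Ma a0] := ideal_neq0_mem iM Mn0.
pose J := [set z | forall x, M x -> @fr1 R (z * x%:F)].
have [R0 RD RM _] := fractional_ideal1 R.
have fJ : fractional_ideal J.
  split=> [x _|z w Jz Jw x Mx|r z Jz x Mx|].
  - by rewrite mul0r.
  - by rewrite mulrDl; apply: RD; [apply: Jz|apply: Jw].
  - by rewrite -mulrA; apply/RM/Jz.
  - by exists a => // z /(_ _ Ma)[r _ rE]; exists r; rewrite rE mulrC.
exists J => //; have [JM0 JMD JMM _] := fractional_idealM fJ (fractional_inK iM).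
apply/seteqP; split; first by apply: frmul_sub => // z _ Jz [x Mx <-]; apply: Jz.
suff JM1 : frmul J (inK M) 1 by move=> _ [r _ <-]; rewrite -[r%:F]mulr1; apply: JMM.
have /existsNP[x /not_implyP[Mx yx]] : ~ forall x, M x -> inK M (y * x%:F).
  by move=> /(stable_fr1 iM Mn0).
have [r _ rE] := yM _ Mx; have [|c Mc] := @maximal_inv_mod R M r mM.
  by move=> Mr; apply: yx; rewrite -rE; apply/inKE.
(* [1 = 1 * (1 - c * r) + (c * y) * x] with [r = y * x] *)
rewrite -(subrK (c * r)%:F 1) -{1}(rmorph1 tofrac) -rmorphB; apply: JMD.
  rewrite -[X in frmul _ _ X]mul1r; apply: frmul_mem; last exact/inKE.
  by move=> z _; rewrite mul1r; apply: fr1_tofrac.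
rewrite rmorphM /= rE mulrA; apply: frmul_mem; last exact/inKE.
by move=> z Mz; rewrite -mulrA; apply/RM/yM.
Qed.

(** Every nonzero ideal is a product of maximal ideals: if [M] is a maximal
    ideal containing [I], then [I] is the product of [M] and the strictly
    larger ideal [M^-1 I]. *)
Lemma ideal_ind (Phi : set K -> Prop) :
    Phi (@fr1 R) ->
    (forall M X, is_maximal M -> M <> [set 0] -> Phi X -> Phi (frmul (inK M) X)) ->
  forall I, is_ideal I -> I <> [set 0] -> Phi (inK I).
Proof.
move=> Phi1 PhiM I iI In0; apply: contrapT => nPhi.
pose F := [set I | [/\ is_ideal I, I <> [set 0] & ~ Phi (inK I)]].
have [||{}I [{}iI {}In0 {}nPhi] maxI] := @noetherian_max R F I noethR.
- by move=> ? [].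
- by split.
have [I1|I1] := pselect (I 1); first by apply: nPhi; rewrite (ideal_unit iI I1).
have [M mM IM] := maximal_exists noethR iI I1.
have Mn0 : M <> [set 0].
  move=> M0; apply: In0; apply/seteqP; split=> [x /IM|_ ->]; first by rewrite M0.
  by case: iI.
have [fM [J fJ JM]] := maximal_invertible mM Mn0.
have fI := fractional_inK iI.
have J1 : J 1.
  have J0 : frmul J (inK M) `<=` J.
    by rewrite -{2}[J]frmulr1//; apply: frmulS => //; apply: inK_fr1.
  by apply: J0; rewrite JM -(rmorph1 tofrac); apply: fr1_tofrac.
have [I' iI' JII'] : exists2 I', is_ideal I' & frmul J (inK I) = inK I'.
  apply: fractional_sub1; first exact: fractional_idealM.
  by rewrite -JM; apply: frmulS => // _ [x /IM Mx <-]; apply/inKE.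
have IMI' : inK I = frmul (inK M) (inK I').
  by rewrite -JII' frmulA (frmulC _ J) JM frmul1.
have II' : I `<=` I'.
  by move=> x Ix; apply/inKE; rewrite -JII' -[x%:F]mul1r; apply: frmul_mem => //; exists x.
have : ~ F I'.
  move=> FI'; have I'I := maxI _ FI' II'; move: JII'; rewrite I'I => JI.
  (* [J * I = I] makes the elements of [J] integral, and [M = R]. *)
  have J_sub : J `<=` @fr1 R.
    move=> y Jy; apply: (stable_fr1 iI In0) => x Ix; rewrite -JI.
    by apply: frmul_mem => //; exists x.
  have [_ M1 _] := mM; apply: M1; apply/inKE.
  rewrite -[inK M]frmul1//; apply: (frmulS J_sub (@subset_refl _ _)).
  by rewrite JM; apply: fr1_tofrac.
apply; split=> // [I'0|PhiI']; last by apply: nPhi; rewrite IMI'; apply: PhiM.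
by have [x Ix /eqP x0] := ideal_neq0_mem iI In0; apply: x0; have := II' _ Ix; rewrite I'0.
Qed.

Lemma ideal_invertible I : is_ideal I -> I <> [set 0] -> invertible (inK I).
Proof.
apply: ideal_ind => [|M X mM Mn0 iX]; first exact: invertible1.
by apply: invertibleM => //; apply: maximal_invertible.
Qed.

(** In the factorization of [I] only [M] can occur, since every maximal ideal
    containing [I] contains [M]. *)
Lemma primary_power M I :
    is_maximal M -> is_ideal I -> I <> [set 0] ->
    (forall x, M x -> exists k, I (x ^+ k)) ->
  exists n, inK I = frpow (inK M) n.
Proof.
move=> mM iI In0 MI.
pose Phi X := [/\ fractional_ideal X, X `<=` @fr1 R &
  (forall x, M x -> exists k, X (x ^+ k)%:F) -> exists n, X = frpow (inK M) n].
suff [_ _] : Phi (inK I) by apply=> x /MI[k Ik]; exists k; apply/inKE.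
move: I iI In0 {MI}; apply: ideal_ind => [|M' X mM' M'n0 [fX X1 XM]].
  by split; [exact: fractional_ideal1|by []|exists 0%N].
have fM' : fractional_ideal (inK M') by apply: fractional_inK; case: mM'.
have M'X : frmul (inK M') X `<=` inK M'.
  by rewrite -{2}[inK M']frmulr1//; apply: frmulS.
have XM'X : frmul (inK M') X `<=` X.
  by rewrite -{2}[X]frmul1//; apply: frmulS => //; apply: inK_fr1.
split; [exact: fractional_idealM|exact: subset_trans X1|move=> MX].
have M'M : M' = M.
  apply: maximal_sub => //; [exact: maximal_prime|move=> x /MX[k /M'X/inKE]].
  exact: (primeX (maximal_prime mM')).
have [x /MX[k /XM'X Xk]|n ->] := XM; first by exists k.
by exists n.+1; rewrite M'M.
Qed.

End Dedekind.
End FractionalIdeals.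

(** * Prime ideals of a polynomial ring *)

Section PolyIdeals.
Local Open Scope ring_scope.
Local Open Scope classical_set_scope.
Variable R : idomainType.
Implicit Types (p : set R) (P Q : set {poly R}).

(** The ideal [p R[X]], given by its coefficients. *)
Definition polyI p : set {poly R} := [set f | forall i, p f`_i].

Definition contraction P : set R := [set r | P r%:P].

Lemma prime0 : is_prime [set (0 : R)].
Proof.
apply/is_primeP; split; first exact: ideal_zero.
  by move=> /eqP; rewrite oner_eq0.
by move=> u v /eqP; rewrite mulf_eq0 => /orP[] /eqP; [left|right].
Qed.

Lemma polyI_ideal p : is_ideal p -> is_ideal (polyI p).
Proof.
move=> ip; case: (ip) => p0 pD pM; split=> [i|f g pf pg i|a f pf i].
- by rewrite coef0.
- by rewrite coefD; apply: pD.
- by rewrite coefM; apply: ideal_sum => // j _; apply: pM.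
Qed.

(** If neither [f] nor [g] is in [p R[X]], let [i] and [j] be the first indices
    of a coefficient outside [p]; modulo [p], the coefficient of [f * g] of
    index [i + j] is [f`_i * g`_j]. *)
Lemma polyI_prime p : is_prime p -> is_prime (polyI p).
Proof.
move=> pp; have ip := prime_ideal pp; case: (ip) => p0 pD pM.
have first f : ~ polyI p f ->
    exists i, ~ p f`_i /\ forall j, (j < i)%N -> p f`_j.
  move=> /existsNP[k fk].
  have [|i /asboolP fi imin] := @ex_minnP (fun i => `[< ~ p f`_i >]).
    by exists k; apply/asboolP.
  exists i; split=> // j ji; apply: contrapT => fj.
  have /imin : `[< ~ p f`_j >] by apply/asboolP.
  by rewrite leqNgt ji.
apply/is_primeP; split; first exact: polyI_ideal.
  by move=> /(_ 0%N); rewrite coef1; apply: prime1.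
move=> f g fg; apply: contrapT => /not_orP[/first[i [fi fl]] /first[j [gj gl]]].
have := fg (i + j)%N; rewrite coefM.
have ij : (i < (i + j).+1)%N by rewrite ltnS leq_addr.
rewrite (bigD1 (Ordinal ij))//= addKn; set rest := \sum_(k < _ | _) _ => pS.
have prest : p rest.
  apply: ideal_sum => // -[k kij]; rewrite -val_eqE /= neq_ltn => /orP[ki|ik].
    by apply: idealMr => //; apply: fl.
  by apply/pM/gl; rewrite ltn_subLR// -ltnS// ltnS ltn_add2r.
have : p (f`_i * g`_j) by rewrite -[X in p X](addrK rest); apply: idealB.
by case/(primeM pp).
Qed.

Lemma contraction_prime P : is_prime P -> is_prime (contraction P).
Proof.
case/is_primeP=> -[P0 PD PM] P1 Pp; apply/is_primeP; split; first split.
- by rewrite /contraction /= polyC0.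
- by move=> x y Px Py; rewrite /contraction /= polyCD; apply: PD.
- by move=> a x Px; rewrite /contraction /= polyCM; apply: PM.
- by rewrite /contraction /= polyC1.
- by move=> u v; rewrite /contraction /= polyCM => /Pp.
Qed.

Lemma polyI_contraction P : is_ideal P -> polyI (contraction P) `<=` P.
Proof.
move=> iP f Pf; rewrite -[f]coefK poly_def; apply: ideal_sum => // i _.
by rewrite -mul_polyC; apply: idealMr => //; apply: Pf.
Qed.

Lemma contraction_polyI p : p 0 -> contraction (polyI p) = p.
Proof.
move=> p0; apply/seteqP; split=> [r /(_ 0%N)|r pr i]; rewrite coefC//.
by case: ifP.
Qed.

Lemma polyI0 : polyI [set 0] = [set 0].
Proof.
apply/seteqP; split=> [f f0|_ -> i]; last by rewrite coef0.
by apply/polyP => i; rewrite coef0; apply: f0.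
Qed.

(** Modulo [p R[X]] this is the existence of a polynomial of least degree in
    the nonzero ideal [P / p R[X]] of a polynomial ring over a domain. *)
Lemma least_size_exists P (p := contraction P) :
    is_prime P -> P <> polyI p ->
  exists g, [/\ P g, ~ p (lead_coef g) &
    forall h, P h -> (size h < size g)%N -> polyI p h].
Proof.
move=> pP Pp; have iP := prime_ideal pP.
have ip : is_ideal p by apply/prime_ideal/contraction_prime.
have [f Pf pf] : exists2 f, P f & ~ polyI p f.
  apply: contrapT => nf; apply: Pp; apply/seteqP; split; last exact: polyI_contraction.
  by move=> f Pf; apply: contrapT => pf; apply: nf; exists f.
have [|n /asboolP[g [Pg pg <-]] gmin] := @ex_minnP
    (fun n => `[< exists g, [/\ P g, ~ polyI p g & size g = n] >]).
  by exists (size f); apply/asboolP; exists f.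
have {}gmin h : P h -> (size h < size g)%N -> polyI p h.
  move=> Ph hg; apply: contrapT => ph; suff : (size g <= size h)%N by rewrite leqNgt hg.
  by apply: gmin; apply/asboolP; exists h.
have g0 : g != 0 by apply: contra_notN pg => /eqP -> i; rewrite coef0; case: ip.
(* [h] is [g] without its leading term, which would be in [p R[X]]. *)
exists g; split=> // pl; apply: pg; pose h := \poly_(i < (size g).-1) g`_i.
have pgh : polyI p (g - h).
  move=> i; rewrite coefB coef_poly; case: ltnP => [_|gi]; first by rewrite subrr; case: ip.
  rewrite subr0; move: gi; rewrite leq_eqVlt => /predU1P[<- //|gi].
  by rewrite nth_default; [case: ip|rewrite -[size g]prednK ?size_poly_gt0].
have Ph : P h.
  rewrite -[h](subKr g); apply: idealB => //.
  exact: (polyI_contraction iP pgh).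
rewrite -[g](subrK h); case: (polyI_ideal ip) => _ pID _; apply: pID => //.
by apply: gmin => //; rewrite (leq_ltn_trans (size_poly _ _))// prednK ?size_poly_gt0.
Qed.

(** Pseudo-division by [g] works because its leading coefficient is invertible
    outside [p]; the remainder is in [P] and too small to be outside [p R[X]]. *)
Lemma least_size_division P g h (p := contraction P) :
    is_prime P -> P g -> ~ p (lead_coef g) ->
    (forall h, P h -> (size h < size g)%N -> polyI p h) -> P h ->
  exists s q r, [/\ ~ p s, s *: h = q * g + r, polyI p r,
    (size r < size g)%N & size q = (size h - (size g).-1)%N].
Proof.
move=> pP Pg pl gmin Ph; have pp := contraction_prime pP; have iP := prime_ideal pP.
have g0 : g != 0.
  by apply/eqP => g0; apply: pl; rewrite g0 lead_coef0; case: (prime_ideal pp).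
have hE := Pdiv.Idomain.divp_eq h g.
have rg : (size (h %% g)%R < size g)%N by rewrite Pdiv.Idomain.ltn_modp.
exists (lead_coef g ^+ scalp h g), (h %/ g), (h %% g); split=> //.
- by move=> /(primeX pp).
- apply: gmin => //; rewrite -[_ %% _](addKr (h %/ g * g)) -hE addrC.
  rewrite -mul_polyC; case: (iP) => _ _ PM.
  by apply: idealB => //; apply: PM.
- exact: Pdiv.Idomain.size_divp.
Qed.

(** Localizing at [R \ p] and reducing modulo [p], both become primes of a
    polynomial ring over a field, where nonzero primes are maximal. *)
Lemma incomparability P Q :
    is_prime P -> is_prime Q -> P `<` Q -> contraction P = contraction Q ->
  P = polyI (contraction P).
Proof.
move=> pP pQ [PQ QP] PQE; apply: contrapT => Pn; apply: QP.
set p := contraction P in PQE Pn *.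
have pp : is_prime p by apply: contraction_prime.
have iP := prime_ideal pP; have iQ := prime_ideal pQ.
case: (iP) => P0 PD PM; case: (iQ) => Q0 QD QM.
have pIP := polyI_contraction iP.
have Qn : Q <> polyI (contraction Q).
  rewrite -PQE => QE; apply: Pn; apply/seteqP; split; last exact: pIP.
  by rewrite -QE.
have [g [Pg pg gmin]] := least_size_exists pP Pn.
have [g' [Qg' pg' g'min]] := least_size_exists pQ Qn.
have [s [q [r [ps sg pr rg' qE]]]] := least_size_division pQ Qg' pg' g'min (PQ _ Pg).
rewrite -PQE in ps pr.
have /(primeM pP)[Pq|Pg'] : P (q * g').
  rewrite -[q * g'](addrK r) -sg -mul_polyC; apply: idealB => //; first exact: PM.
  exact: pIP.
- have g0 : (0 < size g)%N.
    rewrite size_poly_gt0; apply: contra_notN pg => /eqP ->.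
    by rewrite lead_coef0; case: (prime_ideal pp).
  exfalso; apply: pg; have : polyI p (s *: g).
    have ipI := polyI_ideal (prime_ideal pp).
    rewrite sg; case: (ipI) => _ pID _; apply: pID => //; apply: (idealMr _ ipI).
    apply: gmin => //; rewrite qE.
    have g'1 : (1 < size g')%N.
      rewrite ltnNge; apply/negP => /size1_polyC g'C; apply: pg'.
      by move: Qg'; rewrite g'C lead_coefC.
    by rewrite ltn_subrL g0 andbT -subn1 subn_gt0.
  by move=> /(_ (size g).-1); rewrite coefZ => /(primeM pp)[].
- move=> h Qh; have [t [u [v [pt th pv _ _]]]] := least_size_division pQ Qg' pg' g'min Qh.
  rewrite -PQE in pt pv; have /(primeM pP)[] // : P (t%:P * h).
  by rewrite mul_polyC th; apply: PD; [apply: PM|apply: pIP].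
Qed.

End PolyIdeals.

(** * Polynomials over the fraction field *)

Section PolyFractions.
Local Open Scope ring_scope.
Local Open Scope classical_set_scope.
Variable R : idomainType.
Local Notation K := {fraction R}.
Local Notation tofrac := (@FracField.tofrac R).
Local Notation "x %:F" := (tofrac x).
Implicit Types (I J M p : set R) (P Q : set {poly R}) (X Y : set K).

Definition toK : {poly R} -> {poly K} := map_poly tofrac.

Lemma toK_inj : injective toK.
Proof. by apply: map_inj_poly; [exact: tofrac_inj|rewrite rmorph0]. Qed.

Lemma coef_toK f i : (toK f)`_i = (f`_i)%:F.
Proof. exact: coef_map. Qed.

Lemma toKM f g : toK (f * g) = toK f * toK g.
Proof. exact: rmorphM. Qed.

Lemma toKX f n : toK (f ^+ n) = toK f ^+ n.
Proof. exact: rmorphXn. Qed.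

Lemma toKZ a f : toK (a *: f) = a%:F *: toK f.
Proof. exact: map_polyZ. Qed.

Lemma fr1_poly (f : {poly K}) : (forall i, @fr1 R f`_i) -> exists g, f = toK g.
Proof.
move=> fR; have /choice[c cE] : forall i, exists c, c%:F = f`_i.
  by move=> i; have [c _ cE] := fR i; exists c.
exists (\poly_(i < size f) c i); apply/polyP => i; rewrite coef_toK coef_poly.
by case: ltnP => [_|fi]; rewrite ?cE// rmorph0 nth_default.
Qed.

Lemma common_denominator (f : {poly K}) :
  exists2 d : R, d != 0 & exists g, d%:F *: f = toK g.
Proof.
elim/poly_ind: f => [|f z [d d0 [g gE]]].
  by exists 1; rewrite ?oner_neq0//; exists 0; rewrite scaler0 /toK rmorph0.
have [b b0 [a aE]] := fracP z; exists (d * b); first by rewrite mulf_neq0.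
exists ((b *: g) * 'X + (d * a)%:P); apply/polyP => i.
rewrite coef_toK coefZ !coefD !coefMX !coefC coefZ mulrDr !rmorphD.
case: i => [|i]; rewrite /= ?(rmorph0, mulr0, addr0, add0r) !rmorphM /=.
  by rewrite -aE; ring.
by rewrite -coef_toK -gE coefZ; ring.
Qed.

Lemma coefM_frmul X Y (f g : {poly K}) k :
  (forall i, X f`_i) -> (forall i, Y g`_i) -> frmul X Y (f * g)`_k.
Proof.
move=> Xf Yg; rewrite coefM; elim/big_ind: _ => [|x y|i _].
- exact: frmul0.
- exact: frmulD.
- exact: frmul_mem.
Qed.

Lemma coefX_frpow X (f : {poly K}) n k : (forall i, X f`_i) -> frpow X n (f ^+ n)`_k.
Proof.
move=> Xf; elim: n k => [|n IHn] k; last by rewrite exprS; apply: coefM_frmul.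
by rewrite expr0 coef1; exists (k == 0)%:R; rewrite ?rmorph_nat.
Qed.

Definition content (f : {poly R}) : set R := ideal_gen (fun i : 'I_(size f) => f`_i).

Lemma content_coef f i : content f f`_i.
Proof.
have [fi|fi] := ltnP i (size f); first exact: (ideal_gen_mem _ (Ordinal fi)).
by rewrite nth_default//; case: (ideal_gen_ideal (fun i : 'I_(size f) => f`_i)).
Qed.

Lemma content_neq0 f : f != 0 -> content f <> [set 0].
Proof.
move=> f0 c0; have := content_coef f (size f).-1.
by rewrite c0 => /eqP; rewrite -/(lead_coef f) lead_coef_eq0 (negPf f0).
Qed.

Section Dedekind.
Hypothesis dedR : dedekind R.

(** Locally at [M] every polynomial over [K] is a scalar multiple of a primitive
    one: once denominators are cleared, the scalar is an element of the inverse
    of the content which does not send the content into [M]. *)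
Lemma primitive_multiple M (f : {poly K}) :
  is_maximal M -> f != 0 -> exists (u : K) g, u *: f = toK g /\ ~ polyI M g.
Proof.
move=> mM f0; have [d d0 [g gE]] := common_denominator f.
have g0 : g != 0.
  apply/eqP => g0; move: gE => /eqP; rewrite g0 /toK rmorph0 scaler_eq0 tofrac_eq0.
  by rewrite (negPf d0) (negPf f0).
have [_ [J fJ JI]] := ideal_invertible dedR (ideal_gen_ideal _) (content_neq0 g0).
have [u Ju [i ugi]] : exists2 u, J u & exists i, ~ inK M (u * (g`_i)%:F).
  apply: contrapT => nJ; have [iM M1 _] := mM; apply/M1/inKE.
  have [M0 MD MM _] := fractional_inK iM.
  suff : frmul J (inK (content g)) `<=` inK M by apply; rewrite JI; apply: fr1_tofrac.
  apply: frmul_sub => // u _ Ju [_ [c ->] <-].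
  rewrite rmorph_sum mulr_sumr; elim/big_ind: _ => // j _.
  rewrite rmorphM mulrCA; apply: MM; apply: contrapT => ug.
  by apply: nJ; exists u => //; exists j.
have [h hE] : exists h, u *: toK g = toK h.
  apply: fr1_poly => j; rewrite coefZ coef_toK -JI; apply: frmul_mem => //.
  exact/inKE/content_coef.
exists (u * d%:F), h; split; first by rewrite -scalerA gE.
move=> /(_ i) /inKE; rewrite -coef_toK -hE coefZ coef_toK.
exact: ugi.
Qed.

(** Gauss' lemma: contents are multiplicative because locally the product of
    two primitive polynomials is primitive. *)
Lemma gauss_lemma (f g : {poly K}) h i j : f * g = toK h -> @fr1 R (f`_i * g`_j).
Proof.
move=> fgE; have [R0 RD RM _] := fractional_ideal1 R.
have [->|f0] := eqVneq f 0; first by rewrite coef0 mul0r.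
have [->|g0] := eqVneq g 0; first by rewrite coef0 mulr0.
pose D := [set s : R | @fr1 R (s%:F * (f`_i * g`_j))].
have iD : is_ideal D.
  split=> [|x y Dx Dy|a x Dx]; rewrite /D /=.
  - by rewrite rmorph0 mul0r.
  - by rewrite rmorphD mulrDl; apply: RD.
  - by rewrite rmorphM -mulrA; apply: RM.
have [D1|D1] := pselect (D 1); first by move: D1; rewrite /D /= rmorph1 mul1r.
have [noethR _ _] := dedR; have [M mM DM] := maximal_exists noethR iD D1.
have [u [f' [f'E Mf']]] := primitive_multiple mM f0.
have [v [g' [g'E Mg']]] := primitive_multiple mM g0.
have pM := maximal_prime mM.
have : ~ polyI M (f' * g') by move=> /(primeM (polyI_prime pM))[].
have fgE' : toK (f' * g') = (u * v) *: toK h.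
  by rewrite toKM -f'E -g'E -scalerAl -scalerAr scalerA fgE.
case/existsNP=> k []; apply: DM; rewrite /D /=.
rewrite -coef_toK fgE' coefZ coef_toK.
rewrite (_ : _ * _ = (f'`_i * g'`_j * h`_k)%:F); first exact: fr1_tofrac.
by rewrite !rmorphM /= -!coef_toK -f'E -g'E !coefZ; ring.
Qed.

(** * Heights in the polynomial ring over a Dedekind domain *)

(** A nonzero prime [Q] strictly contained in [M R[X]] contracts to zero, hence
    contains a primitive multiple of any nonzero element of [Q]; but such a
    multiple is not in [M R[X]]. *)
Lemma polyI_height1 M :
  is_maximal M -> M <> [set 0] -> prime_height (polyI M) 1.
Proof.
move=> mM Mn0; have pM := maximal_prime mM; have [_ _ dim1] := dedR.
have p0 : is_prime [set (0 : {poly R})] by rewrite -polyI0; apply/polyI_prime/prime0.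
apply: prime_height1 => //; first exact: polyI_prime.
  move=> MI; apply: Mn0; rewrite -(contraction_polyI (p := M)); last by case: mM => -[].
  by rewrite MI; apply/seteqP; split=> x; rewrite /contraction /= => /eqP;
    rewrite ?polyC_eq0 => /eqP // ->.
move=> Q pQ [QM MQ]; have iQ := prime_ideal pQ.
apply/seteqP; split=> [f Qf|_ ->]; last by case: iQ.
have Q0 : contraction Q = [set 0].
  apply: contrapT => Qn0; apply: MQ.
  rewrite (_ : M = contraction Q); first exact: polyI_contraction.
  apply: maximal_sub => //; first by apply: dim1 => //; apply: contraction_prime.
  by move=> x /QM /(_ 0%N); rewrite coefC.
apply: contrapT => /eqP f0; have Kf0 : toK f != 0.
  by rewrite -(rmorph0 (map_poly tofrac)) (inj_eq toK_inj).
have [u [g [ufg Mg]]] := primitive_multiple mM Kf0.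
apply/Mg/QM; have [b b0 [a aE]] := fracP u.
have /(primeM pQ)[Qb|//] : Q (b%:P * g).
  rewrite mul_polyC (_ : b *: g = a%:P * f); first by case: iQ => _ _; apply.
  by apply: toK_inj; rewrite mul_polyC !toKZ -ufg scalerA aE.
by move: b0; have : contraction Q b by []; rewrite Q0 => ->; rewrite eqxx.
Qed.

End Dedekind.

Lemma contraction0_height1 P :
  is_prime P -> contraction P = [set 0] -> P <> [set 0] -> prime_height P 1.
Proof.
move=> pP P0 Pn0.
apply: prime_height1 => //; first by rewrite -polyI0; apply/polyI_prime/prime0.
move=> Q pQ QP; have Q0 : contraction Q = [set 0].
  apply/seteqP; split=> [x Qx|_ ->]; first by rewrite -P0; case: QP => QP _; apply: QP.
  by case: (prime_ideal (contraction_prime pQ)).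
by rewrite (incomparability pQ pP QP) ?Q0 ?P0// polyI0.
Qed.

(** A prime strictly contained in [P] contracts to zero or is [M R[X]], so its
    height is at most one. *)
Lemma height_two P (M := contraction P) :
    dedekind R -> is_prime P -> is_maximal M -> M <> [set 0] -> P <> polyI M ->
  prime_height P 2.
Proof.
move=> dedR pP mM Mn0 PM; have [_ _ dim1] := dedR.
have iP := prime_ideal pP; have hM := polyI_height1 dedR mM Mn0.
apply: (prime_heightS pP hM).
  split; first exact: polyI_contraction.
  by move=> PM'; apply: PM; apply/seteqP; split=> //; apply: polyI_contraction.
move=> Q pQ QP.
have cQP : contraction Q `<=` M by move=> x; case: QP => QP _; apply: QP.
have [Q0|Qn0] := pselect (contraction Q = [set 0]).
  have [->|Qn] := pselect (Q = [set 0]); last by have [] := contraction0_height1 pQ Q0 Qn.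
  have [|_ h0] := @prime_height0 {poly R}.
    by rewrite -polyI0; apply/polyI_prime/prime0.
  by move=> m c cc cm; apply: leq_trans (h0 _ _ cc cm) _.
have QM : M = contraction Q.
  apply: maximal_sub cQP; last exact: maximal_prime.
  exact/dim1/Qn0/contraction_prime.
by rewrite (incomparability pQ pP QP) ?QM -?QM//; case: hM.
Qed.

End PolyFractions.

Section Directions.
Local Open Scope ring_scope.
Local Open Scope classical_set_scope.
Variable R : idomainType.
Local Notation K := {fraction R}.
Local Notation tofrac := (@FracField.tofrac R).
Local Notation "x %:F" := (tofrac x).
Implicit Types (I J M p : set R) (P Q : set {poly R}) (X Y : set K).

Lemma dvd_polyC (f : {poly R}) a :
  (forall i, exists c, f`_i = c * a) -> exists g, f = g * a%:P.
Proof.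
move=> /choice[c cE]; exists (\poly_(i < size f) c i); apply/polyP => i.
rewrite coefMC coef_poly cE; case: ltnP => // fi.
by rewrite mul0r -cE nth_default.
Qed.

(** * Prime ideals over a Dedekind domain with torsion class group *)

Section Torsion.
Hypothesis dedR : dedekind R.
Hypothesis torR : torsion (class_group R).

(** A generator of [I ^ n] may be taken in [I] itself, as [n] is positive. *)
Lemma torsion_generator I : is_ideal I -> I <> [set 0] ->
  exists n a, [/\ a != 0, I a & frpow (inK I) n.+1 = frscale a%:F (@fr1 R)].
Proof.
move=> iI In0; have /torsion_class_groupP tor := torR.
have [[//|n] _ [x x0 xE]] := tor _ (ideal_invertible dedR iI In0).
have fI := fractional_inK iI; have Ix : inK I x.
  apply: (frpow_sub (n := n) fI (@inK_fr1 _ _)); rewrite /frpow xE.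
  by exists 1; [exists 1; rewrite ?rmorph1|rewrite mulr1].
case: Ix xE x0 => a Ia <- aE; rewrite tofrac_eq0 => a0.
by exists n, a.
Qed.

(** The coefficients of [f ^ n] are in [I ^ n = a R]. *)
Lemma dvd_exp I n a (f : {poly R}) :
    frpow (inK I) n = frscale a%:F (@fr1 R) -> polyI I f ->
  exists g, f ^+ n = g * a%:P.
Proof.
move=> aE If; apply: dvd_polyC => i.
have : frpow (inK I) n (toK f ^+ n)`_i.
  by apply: coefX_frpow => j; rewrite coef_toK; apply/inKE/If.
rewrite aE -toKX coef_toK => /frscale1P[r]; rewrite -rmorphM => /tofrac_inj ->.
by exists r.
Qed.

Lemma polyI_stci M : is_maximal M -> M <> [set 0] ->
  set_theoretic_complete_intersection (polyI M).
Proof.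
move=> mM Mn0; have iM : is_ideal M by case: mM.
have [n [a [a0 Ma aE]]] := torsion_generator iM Mn0.
apply: (@stci_intro _ _ 1%N (fun=> a%:P)); first exact: polyI_height1.
  by move=> _ i; rewrite coefC; case: ifP => // _; case: iM.
by move=> f /(dvd_exp aE)[g fE]; exists n.+1; apply/ideal_gen1P; exists g.
Qed.

(** Modulo [M R[X]] the prime [P] is generated by one polynomial [g], and
    [M R[X]] is the radical of an element [a]; so [P] is that of [(g, a)]. *)
Lemma height2_stci P (M := contraction P) :
    is_prime P -> M <> [set 0] -> P <> polyI M ->
  set_theoretic_complete_intersection P.
Proof.
move=> pP Mn0 PM; have [_ _ dim1] := dedR.
have pM : is_prime M by apply: contraction_prime.
have mM : is_maximal M by apply: dim1.
have iM := prime_ideal pM; have [n [a [a0 Ma aE]]] := torsion_generator iM Mn0.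
have [g [Pg Mg gmin]] := least_size_exists pP PM.
apply: (@stci_intro _ _ 2 (fun i => if i == ord0 then g else a%:P)).
- exact: height_two.
- by move=> i; case: ifP.
move=> h Ph; have [s [q [r [Ms sh Mr _ _]]]] := least_size_division pP Pg Mg gmin Ph.
have [c Mc] := maximal_inv_mod mM Ms.
(* [c] is an inverse of [s] modulo [M]: this is a division of [h] itself by [g],
   with a remainder in [M R[X]]. *)
pose r' := c%:P * r + (1 - c * s)%:P * h.
have hE : h = c%:P * q * g + r'.
  rewrite /r' polyCB polyC1 polyCM; have := sh; rewrite -mul_polyC => sh'.
  by ring: sh'.
have Mr' : polyI M r'.
  have [_ MID MIM] := polyI_ideal iM; apply: MID; first exact: MIM.
  by apply: (idealMr _ (polyI_ideal iM)) => i; rewrite coefC; case: ifP => // _; case: iM.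
have [k rE] := dvd_exp aE Mr'; exists n.+1.
pose S := \sum_(i < n.+1) h ^+ (n - i) * r' ^+ i.
exists (fun i => if i == ord0 then S * (c%:P * q) else k).
rewrite big_ord_recl big_ord1 /= -rE; apply/eqP; rewrite -subr_eq.
rewrite subrXX -/S {1}hE addrK.
by rewrite mulrC mulrA.
Qed.

(** The generator of [P K[X]] can be taken in [R[X]]; its [n]-th power is
    divisible by a generator [a] of the [n]-th power of its content, and the
    quotient [f] is primitive. If [h] in [P] is [g * q] then [h ^ n] is
    [f * (a * q ^ n)], and by Gauss' lemma the second factor is in [R[X]]. *)
Lemma contraction0_stci P :
    is_prime P -> contraction P = [set 0] -> P <> [set 0] ->
  set_theoretic_complete_intersection P.
Proof.
move=> pP P0 Pn0; have iP := prime_ideal pP.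
have Pn : P <> polyI (contraction P) by rewrite P0 polyI0.
have [g [Pg cg gmin]] := least_size_exists pP Pn.
have g0 : g != 0 by apply: contra_notN cg => /eqP ->; rewrite P0 lead_coef0.
have iI := ideal_gen_ideal (fun i : 'I_(size g) => g`_i).
have [n [a [a0 Ia aE]]] := torsion_generator iI (content_neq0 g0).
have [f fE] := dvd_exp aE (content_coef g).
have Pf : P f.
  have /(primeM pP)[//|Pa] : P (f * a%:P) by rewrite -fE; exact: (idealX n iP Pg).
  by move: a0; have : contraction P a by []; rewrite P0 => ->; rewrite eqxx.
apply: (@stci_intro _ _ 1%N (fun=> f)) => //; first exact: contraction0_height1.
move=> h Ph; have [s [q [r [s0 sh r0 _ _]]]] := least_size_division pP Pg cg gmin Ph.
have r00 : r = 0 by move: r0; rewrite P0 polyI0.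
rewrite r00 addr0 in sh; rewrite P0 in s0.
have sF : s%:F != 0 by rewrite tofrac_eq0; apply/eqP.
pose w := s%:F^-1 *: toK q; have hE : w * toK g = toK h.
  by rewrite -scalerAl -toKM -sh toKZ scalerA mulVf// scale1r.
pose L := [set z : K | forall x, inK (content g) x -> @fr1 R (z * x)].
have [R0 RD RM _] := fractional_ideal1 R.
have Lw i : L w`_i.
  move=> _ [_ [c ->] <-]; rewrite rmorph_sum mulr_sumr.
  elim/big_ind: _ => // j _; rewrite rmorphM /= mulrCA; apply: RM.
  by rewrite -coef_toK; apply: (gauss_lemma dedR) hE.
have [k kE] : exists k, a%:F *: w ^+ n.+1 = toK k.
  apply: fr1_poly => i; rewrite coefZ -(frpow1 R n.+1).
  have LI : frmul (inK (content g)) L `<=` @fr1 R.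
    by apply: frmul_sub => // x z Ix Lz; rewrite mulrC; apply: Lz.
  apply: (frpowS_sub LI); rewrite frpow_mul; apply: frmul_mem; last exact: coefX_frpow.
  by rewrite aE; apply/frscale1P; exists 1; rewrite rmorph1 mul1r.
exists n.+1; apply/ideal_gen1P; exists k; apply: toK_inj.
rewrite toKM -kE toKX -hE exprMn -toKX fE toKM /toK map_polyC /= -scalerAl -mul_polyC.
by ring.
Qed.

Lemma prime_stci P : is_prime P -> set_theoretic_complete_intersection P.
Proof.
move=> pP; have [_ _ dim1] := dedR; have iP := prime_ideal pP.
have [P0|Pn0] := pselect (P = [set 0]).
  rewrite P0 in pP *; apply: (@stci_intro _ _ 0%N (fun=> 0)) => //; first exact: prime_height0.
  by move=> _ ->; exists 1%N; exists (fun=> 0); rewrite big_ord0 expr1.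
have [cP0|cPn0] := pselect (contraction P = [set 0]); first exact: contraction0_stci.
have [->|PM] := pselect (P = polyI (contraction P)); last exact: height2_stci.
by apply: polyI_stci => //; apply: dim1 => //; apply: contraction_prime.
Qed.

End Torsion.

(** * Complete intersections force a Dedekind domain with torsion class group *)

(** A proper ideal strictly containing [P] would be contained in a maximal ideal
    [M], and [0 < P < M] would be a chain of length two. *)
Lemma krull_dim1_maximal (P : set R) :
    noetherian R -> krull_dim R 1 -> is_prime P -> P <> [set 0] -> is_maximal P.
Proof.
move=> noethR [_ dimR] pP Pn0; have iP := prime_ideal pP.
split=> //; first exact: prime1.
move=> J iJ PJ J1; apply/seteqP; split=> //; apply: contrapT => JP.
have [M mM JM] := maximal_exists noethR iJ J1.
have c0 : prime_chain 0 (fun=> [set (0 : R)]) by split=> // i _; exact: prime0.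
have [c1 c1c c1P] : exists2 c, prime_chain 1 c & c 1%N = P.
  apply: (prime_chain_rcons c0) => //; split; first by move=> _ ->; case: iP.
  by move=> P0; apply: Pn0; apply/seteqP; split=> // _ ->; case: iP.
have [|c2 c2c _] := prime_chain_rcons c1c (maximal_prime mM).
  rewrite c1P; split; first exact: subset_trans JM.
  by move=> MP; apply: JP; apply: subset_trans MP.
by have := dimR _ _ c2c.
Qed.

Definition ker_eval (z : K) : set {poly R} := [set f | root (toK f) z].

Lemma ker_eval_prime z : is_prime (ker_eval z).
Proof.
apply/is_primeP; rewrite /ker_eval; split; first split=> /=.
- by rewrite /toK rmorph0 root0.
- by move=> f g /rootP fz /rootP gz; apply/rootP; rewrite /toK rmorphD hornerD fz gz addr0.
- by move=> a f fz; rewrite toKM rootM fz orbT.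
- by rewrite /= /toK rmorph1; apply/negP/root1.
- by move=> u v; rewrite /= toKM rootM => /orP.
Qed.

Lemma ker_eval_contraction z : contraction (ker_eval z) = [set 0].
Proof.
apply/seteqP; split=> x; rewrite /contraction /ker_eval /toK /= map_polyC /= rootC tofrac_eq0.
  by move/eqP.
by move=> ->.
Qed.

Lemma char0_unit n : contains_field_char0 R -> exists c : R, c * n.+1%:R = 1.
Proof.
move=> [k [/pcharf0P k0 [phi]]]; exists (phi (n.+1%:R^-1)).
by rewrite -(rmorph_nat phi) -rmorphM mulVf ?rmorph1// k0.
Qed.

(** If the kernel of [X |-> z] is the radical of [f], then [f] is associated to
    a power of [X - z] over [K], and its leading coefficient is a unit because
    it divides a power of a monic polynomial that vanishes at [z]. So
    [(X - z) ^ j] has coefficients in [R] for some [j > 0], one of which is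
    [- j * z], and [j] is a unit in characteristic zero. *)
Lemma stci_integrally_closed :
    contains_field_char0 R ->
    (forall P : set {poly R}, is_prime P -> set_theoretic_complete_intersection P) ->
  integrally_closed R.
Proof.
move=> char0 stci z [p p_monic pz].
have pP := ker_eval_prime z; have P0 := ker_eval_contraction z.
have Pp : ker_eval z p by [].
have Pn0 : ker_eval z <> [set 0].
  by move=> E; move: Pp; rewrite E => p0; have := monic_neq0 p_monic; rewrite p0 eqxx.
have [f Pf fP] := stci_height1 (contraction0_height1 pP P0 Pn0) (stci _ pP).
have [u uf] : exists u, u * lead_coef f = 1.
  have [k [c pE]] := fP _ Pp; exists (lead_coef c).
  by rewrite -lead_coefM -pE; apply/eqP/monic_exp.
have [b b0 [a aE]] := fracP z; have bF : b%:F != 0 by rewrite tofrac_eq0.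
have bX : toK (b%:P * 'X - a%:P) = b%:F *: ('X - z%:P).
  by rewrite /toK rmorphB rmorphM /= !map_polyC map_polyX /= -aE polyCM -mul_polyC mulrBr.
have [k [c kE]] : exists k c, (b%:P * 'X - a%:P) ^+ k = c * f.
  by apply: fP; rewrite /ker_eval /= bX rootZ// root_XsubC.
have : toK f %| ('X - z%:P) ^+ k.
  rewrite -(dvdpZr _ _ (expf_neq0 k bF)) -exprZn -bX -toKX kE toKM.
  exact: dvdp_mull.
move=> /dvdp_exp_XsubCP[j _ /eqpf_eq[e e0 fE]].
have eE : e = (lead_coef f)%:F.
  have := congr1 lead_coef fE.
  rewrite lead_coefZ (monicP (monic_exp _ (monicXsubC z))) mulr1 => <-.
  by rewrite (lead_coef_map_inj (@tofrac_inj R)).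
have ufE : toK (u *: f) = ('X - z%:P) ^+ j.
  by rewrite toKZ fE scalerA eE -rmorphM uf rmorph1 scale1r.
case: j ufE {fE} => [|j] ufE.
  have : root (toK (u *: f)) z by rewrite toKZ rootE hornerZ (rootP Pf) mulr0.
  by rewrite ufE expr0; move/negP: (root1 z).
have [d dE] := char0_unit j char0.
exists (- (d * (u *: f)`_j)); rewrite rmorphN rmorphM /= -coef_toK ufE.
(* the coefficient of index [j] of [(X - z)^(j + 1)] *)
have := @coefPn_prod_XsubC K (nseq j.+1 z).
rewrite !big_nseq size_nseq iter_mulr_1 iter_addr_0 => /(_ isT) /= ->.
by rewrite mulrN opprK -mulr_natl mulrA -(rmorph_nat tofrac) -rmorphM dE rmorph1 mul1r.
Qed.

(** A polynomial whose radical is [M R[X]] divides a nonzero constant, hence is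
    a constant [a], and [a R] is a power of [M] as its radical is [M]. *)
Lemma polyI_stci_power M :
    dedekind R -> is_maximal M -> M <> [set 0] ->
    set_theoretic_complete_intersection (polyI M) ->
  exists n a, a != 0 /\ frpow (inK M) n.+1 = frscale a%:F (@fr1 R).
Proof.
move=> dedR mM Mn0 stci; have [iM M1 _] := mM; have [M0 MD MM] := iM.
have constM x : M x -> polyI M x%:P by move=> Mx i; rewrite coefC; case: ifP.
have [f Mf fP] := stci_height1 (polyI_height1 dedR mM Mn0) stci.
have [b Mb b0] := ideal_neq0_mem iM Mn0.
have [k [c bE]] := fP _ (constM _ Mb).
have cf0 : c * f != 0 by rewrite -bE expf_neq0// polyC_eq0.
have /andP[c0 f0] : (c != 0) && (f != 0) by move: cf0; rewrite mulf_eq0 negb_or.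
have sf : (size f <= 1)%N.
  have : size (c * f) = 1%N by rewrite -bE -polyC_exp size_polyC expf_neq0.
  rewrite size_mul//; move: c0; rewrite -size_poly_gt0.
  by case: (size c) => [//|m] _; rewrite addSn /= => <-; rewrite leq_addl.
have [a fE] : exists a, f = a%:P by exists f`_0; apply: size1_polyC.
have a0 : a != 0 by move: f0; rewrite fE polyC_eq0.
have Ma : M a by have := Mf 0%N; rewrite fE coefC.
pose I := [set x | exists r : R, x = r * a].
have iI : is_ideal I.
  split=> [|_ _ [r ->] [s ->]|d _ [r ->]].
  - by exists 0; rewrite mul0r.
  - by exists (r + s); rewrite mulrDl.
  - by exists (d * r); rewrite mulrA.
have In0 : I <> [set 0].
  by move=> E; have : I a by [exists 1; rewrite mul1r]; rewrite E => /eqP; rewrite (negPf a0).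
have MI x : M x -> exists k, I (x ^+ k).
  move=> /constM/fP[m [g xE]]; exists m, g`_0.
  by have := congr1 (fun p : {poly R} => p`_0) xE; rewrite fE -polyC_exp coefC coefMC.
have IE : inK I = frscale a%:F (@fr1 R).
  apply/seteqP; split=> [_ [_ [r ->] <-]|z /frscale1P[r ->]].
    by apply/frscale1P; exists r; rewrite rmorphM.
  by exists (r * a); [exists r|rewrite rmorphM].
have [[|n] nE] := primary_power dedR mM iI In0 MI; last by exists n, a; rewrite -IE nE.
have : inK I 1 by rewrite nE -(rmorph1 tofrac); apply: fr1_tofrac.
by rewrite -(rmorph1 tofrac) => /inKE[r rE]; case: M1; rewrite rE; apply: MM.
Qed.

Lemma stci_torsion :
    dedekind R ->
    (forall P : set {poly R}, is_prime P -> set_theoretic_complete_intersection P) ->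
  torsion (class_group R).
Proof.
move=> dedR stci; apply/torsion_class_groupP => X [fX [J fJ JX]].
pose Phi Y := exists2 n, (0 < n)%N &
  exists2 x, x != 0 & frpow Y n = frscale x (@fr1 R).
have PhiI I : is_ideal I -> I <> [set 0] -> Phi (inK I).
  move: I; apply: (ideal_ind dedR).
    by exists 1%N => //; exists 1; rewrite ?oner_neq0// frscale1 frpow1.
  move=> M Y mM Mn0 [n n0 [x x0 xE]].
  have [|m [a [a0 aE]]] := polyI_stci_power dedR mM Mn0.
    exact/stci/polyI_prime/maximal_prime.
  exists (m.+1 * n)%N; first by rewrite muln_gt0.
  exists (a%:F ^+ n * x ^+ m.+1).
    by rewrite mulf_neq0// expf_neq0// tofrac_eq0.
  rewrite frpow_mul frpow_exp aE mulnC frpow_exp xE !frpow_scale !frpow1.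
  by rewrite frscale_mul frmul1//; apply: fractional_ideal1.
have [X0 XD XM [d d0 dX]] := fX.
have dF : d%:F != 0 by rewrite tofrac_eq0.
have [I iI IE] : exists2 I, is_ideal I & frscale d%:F X = inK I.
  apply: fractional_sub1; last by move=> _ [x /dX[r dxE] <-]; rewrite dxE; apply: fr1_tofrac.
  split.
  - by exists 0; rewrite ?mulr0.
  - by move=> _ _ [x Xx <-] [y Xy <-]; exists (x + y); [apply: XD|rewrite mulrDr].
  - by move=> r _ [x Xx <-]; exists (r%:F * x); [apply: XM|rewrite mulrCA].
  - exists 1; first exact: oner_neq0.
    by move=> _ [x /dX[r dxE] <-]; exists r; rewrite rmorph1 mul1r.
have In0 : I <> [set 0].
  move=> I0; have /eqP := oner_neq0 K; apply.
  have : frmul J X `<=` [set 0].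
    apply: frmul_sub => //= [x y -> ->|x y _ Xy]; first by rewrite addr0.
    have : inK I (d%:F * y) by rewrite -IE; exists y.
    rewrite I0 => -[_ ->] /esym/eqP; rewrite rmorph0 mulf_eq0 (negPf dF) => /eqP ->.
    by rewrite mulr0.
  by apply; rewrite JX -(rmorph1 tofrac); apply: fr1_tofrac.
have [n n0 [x x0 xE]] := PhiI _ iI In0; exists n => //.
exists (d%:F ^- n * x); first by rewrite mulf_neq0// invr_neq0// expf_neq0.
rewrite -frscaleM -xE -IE frpow_scale frscaleM mulVf ?expf_neq0//.
by rewrite frscale1.
Qed.
End Directions.

Theorem theorem1 (R : idomainType)
    (noethR : noetherian R) (dimR : krull_dim R 1)
    (charR : contains_field_char0 R) :
  (forall P : set {poly R},
     is_prime P -> set_theoretic_complete_intersection P)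
  <-> (dedekind R /\ torsion (class_group R)).
Proof.
split=> [stci|[dedR torR] P]; last exact: prime_stci.
have dedR : dedekind R.
  split=> // [|P pP Pn0]; first exact: stci_integrally_closed.
  exact: krull_dim1_maximal.
by split=> //; apply: stci_torsion.
Qed.
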